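(* For every integer $d\ge 1$ there is a constant $c_d>0$ depending only on $d$ such that the following holds. Let $K\ge 2$ and $n\ge 1$ be integers with $K$ dividing $n$, and let $F$ be any estimator, i.e. any measurable real-valued function of the data $\{Y_i(k)\}_{1\le i\le n/K,\,1\le k\le K}$. Then $$\sup_{\mu_\star}\ \mathbb{E}\left[\left|F\big(\{Y_i(k)\}_{i,k}\big)-\mathrm{MW}_2^2(\mu_\star)\right|\right]\ \ge\ c_d\cdot\begin{cases}n^{-1/2}, & d\le 4,\\ \min\left\{K^{-2}\big((n/K)\log(n/K)\big)^{-2/d},\ n^{-1/2}\right\}, & d>4,\end{cases}$$ where the supremum is over all $K$-tuples $\mu_\star=(\mu_\star(1),\dots,\mu_\star(K))$ of Borel probability measures supported on the unit ball $B_1^d(0)\subset\mathbb{R}^d$, and the expectation is over the data sampled from $\mu_\star$.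
   Context: For probability measures $\mu(1),\dots,\mu(K)$ on $\mathbb{R}^d$, $\Gamma(\mu(1),\dots,\mu(K))$ denotes the set of all couplings, i.e. probability measures $\gamma$ on $(\mathbb{R}^d)^K$ whose $k$-th marginal is $\mu(k)$ for all $k\in\{1,\dots,K\}$. Points of $(\mathbb{R}^d)^K$ are written $y=(y(1),\dots,y(K))$ with $y(k)\in\mathbb{R}^d$. Define $$\mathrm{MW}_2^2(\mu)=\mathrm{MW}_2^2(\mu(1),\dots,\mu(K)):=\inf_{\gamma\in\Gamma(\mu(1),\dots,\mu(K))}\int\left\|\frac{1}{K}\sum_{k=1}^K y(k)\right\|_2^2\,\gamma(dy).$$ $B_1^d(0)$ is the Euclidean unit ball of $\mathbb{R}^d$ centered at $0$. Sampling: $Y_i(k)$, $1\le i\le n/K$, $1\le k\le K$, are $n$ mutually independent random vectors with $Y_i(k)\sim\mu_\star(k)$. When $n=K$, so that $\log(n/K)=0$, the quantity $((n/K)\log(n/K))^{-2/d}$ is read as $+\infty$. *)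

(* Defs.v *)
From HB Require Import structures.
From mathcomp Require Import all_boot all_order all_algebra.
From mathcomp Require Import all_classical all_reals all_analysis.
Set Implicit Arguments.
Unset Strict Implicit.
Unset Printing Implicit Defensive.
Import Order.TTheory GRing.Theory Num.Theory.
Import numFieldNormedType.Exports.
Local Open Scope classical_set_scope.
Local Open Scope ring_scope.

(* R^d with its Borel sigma-algebra. Products (R^d)^K are tuple types, with
   the product sigma-algebra, which is the Borel one by second countability. *)
Notation borel_rV R d := (g_sigma_algebraType (@open 'rV[R]_d)).

(* The library norm on 'rV[R]_d is the sup norm. *)
Definition norm2 (R : realType) (d : nat) (x : 'rV[R]_d) : R :=
  Num.sqrt (\sum_(j < d) x ord0 j ^+ 2).

Definition unit_ball (R : realType) (d : nat) : set (borel_rV R d) :=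
  [set x | norm2 x <= 1].

Definition supported_on d (T : measurableType d) (R : realType)
    (mu : probability T R) (B : set T) : Prop :=
  mu B = 1%E.

Section multimarginal.
Context (R : realType) (d K : nat).
Local Open Scope ereal_scope.

Definition coupling (mu : 'I_K -> probability (borel_rV R d) R) :
    set (probability (K.-tuple (borel_rV R d)) R) :=
  [set gamma | forall (k : 'I_K) (A : set (borel_rV R d)), measurable A ->
     pushforward gamma (fun y => tnth y k) A = mu k A].

Definition barycenter (y : K.-tuple (borel_rV R d)) : 'rV[R]_d :=
  (K%:R^-1 *: \sum_(k < K) (tnth y k : 'rV[R]_d))%R.

Definition MW2sq (mu : 'I_K -> probability (borel_rV R d) R) : \bar R :=
  ereal_inf [set \int[gamma]_y ((norm2 (barycenter y) ^+ 2)%R)%:E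
            | gamma in coupling mu].

End multimarginal.

Section sampling.
Local Open Scope ereal_scope.

Definition mutually_independent (R : realType) dO (Omega : measurableType dO)
    (P : probability Omega R) dT (T : measurableType dT) (I : finType)
    (X : I -> {RV P >-> T}) : Prop :=
  forall (J : {set I}) (A : I -> set T), (forall i, measurable (A i)) ->
    P (\bigcap_(i in [set` J]) X i @^-1` A i) =
    \big[*%E/1]_(i in J) P (X i @^-1` A i).

Definition independent_sample (R : realType) (d m K : nat) dO
    (Omega : measurableType dO) (P : probability Omega R)
    (Y : 'I_m * 'I_K -> {RV P >-> borel_rV R d})
    (mu : 'I_K -> probability (borel_rV R d) R) : Prop :=
  (forall (i : 'I_m) (k : 'I_K) (A : set (borel_rV R d)), measurable A ->
     distribution P (Y (i, k)) A = mu k A) /\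
  mutually_independent Y.

Definition data (R : realType) (d m K : nat) dO (Omega : measurableType dO)
    (P : probability Omega R) (Y : 'I_m * 'I_K -> {RV P >-> borel_rV R d})
    (w : Omega) : m.-tuple (K.-tuple (borel_rV R d)) :=
  [tuple [tuple Y (i, k) w | k < K] | i < m].

End sampling.

Section rate.
Context (R : realType).
Local Open Scope ereal_scope.

(* [`^] vanishes at base 0 for negative exponents, so the value [+oo] at
   [n = K] has to be given separately. *)
Definition nlogn_rate (d K n : nat) : \bar R :=
  if n == K then +oo
  else (((n%:R / K%:R * ln (n%:R / K%:R)) `^ (- (2 / d%:R)))%R)%:E.

Definition minimax_rate (d K n : nat) : \bar R :=
  if (d <= 4)%N then ((n%:R `^ (- 2^-1))%R)%:E
  else Order.min (((K%:R ^- 2)%R)%:E * nlogn_rate d K n)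
                 ((n%:R `^ (- 2^-1))%R)%:E.

End rate.

(* Main.v *)
(** The rate never exceeds [n^(-1/2)], so it is enough to bound the risk below
by a multiple of [n^(-1/2)], which Le Cam's two-point method does on a line.
The [k]-th marginal puts mass [p] on [h k * e_1] and [1 - p] on [0]. The heights
[h k] in [(0, 1]] are chosen so that for [p = 1/2] some coupling, driven by one
fair bit, has the constant barycenter [c e_1], with [c >= 1/3]; thus [MW2sq] is
at most [c^2] there. For [p = 1/2 + e], all means grow by the factor [1 + 2 e],
and [y^2 >= 2 c y - c^2] shows that [MW2sq >= c^2 + 4 c^2 e]. With
[e = n^(-1/2) / 4] the [n] observed bits have bounded chi-square divergence
[(1 + 4 e^2)^n - 1] between the two models. *)
Require Import Defs.
From HB Require Import structures.
From mathcomp Require Import all_boot all_order all_algebra.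
From mathcomp Require Import all_classical all_reals all_analysis.
From mathcomp Require Import measurable_realfun zify ring lra.
Import Order.TTheory GRing.Theory Num.Theory.
Import numFieldNormedType.Exports.
Local Open Scope classical_set_scope.
Local Open Scope ring_scope.
Set Implicit Arguments.
Unset Strict Implicit.
Unset Printing Implicit Defensive.

(** * Two-point testing on a finite sample space *)

(* The bound rests on [min(1, l) >= l - l^2 / 4]. *)
Lemma le_cam_two_point (R : realFieldType) (T : finType) (q l g0 g1 : T -> R)
    (D : R) :
  0 <= D ->
  (forall s, 0 <= q s) -> (forall s, 0 <= l s) ->
  (forall s, 0 <= g0 s) -> (forall s, 0 <= g1 s) ->
  (forall s, D <= g0 s + g1 s) ->
  D * (\sum_s q s * l s - 4^-1 * \sum_s q s * l s ^+ 2) <=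
  \sum_s g0 s * q s + \sum_s g1 s * (q s * l s).
Proof.
move=> D0 q0 l0 g00 g10 gD.
rewrite [_^-1 * _]mulr_sumr -sumrB mulr_sumr -big_split/=; apply: ler_sum => s _.
rewrite [leLHS](_ : _ = q s * (D * (l s - l s ^+ 2 / 4))); last by ring.
rewrite [leRHS](_ : _ = q s * (g0 s + l s * g1 s)); last by ring.
rewrite ler_wpM2l//.
have {q0} := (l0 s, g00 s, g10 s, gD s).
move: (l s) (g0 s) (g1 s) => x y z [[[x0 y0] z0] yz].
(* Used with [m] equal to min(1, x): then m (y + z) <= y + x z, and the bound x - x^2 / 4 <= 1 is (x
   - 2)^2 >= 0. *)
have minx (m : R) : x - x ^+ 2 / 4 <= m -> m * (y + z) <= y + x * z ->
    0 <= m -> D * (x - x ^+ 2 / 4) <= y + x * z.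
  move=> xm mle m0; apply: le_trans mle; apply: (@le_trans _ _ (D * m)).
    exact: ler_wpM2l.
  by rewrite mulrC ler_wpM2l.
have [x1|x1] := leP x 1.
  by apply: (minx x) => //; [have := sqr_ge0 x; lra | nra].
by apply: (minx 1); rewrite ?ler01//; [have := sqr_ge0 (x - 2); lra | nra].
Qed.


(** * Borel measurability of coordinates, points and the cost *)

Section borel_rV.
Context (R : realType) (d : nat).

Lemma measurable_coord (j : 'I_d) : measurable_fun [set: borel_rV R d]
  (fun x : borel_rV R d => (x : 'rV[R]_d) ord0 j).
Proof.
apply: (measurability _ (RGenOpens.measurableE R)).
move=> _ [_ [a [b ->]] <-]; rewrite setTI; apply: sub_sigma_algebra => /=.
have /continuousP := @coord_continuous R 1 d ord0 j.
by apply; exact: interval_open.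
Qed.

(** A point is a finite intersection of coordinate fibres. This makes the events that observe a
    given atom measurable. *)
Lemma measurable_rV1 (x : borel_rV R d) : measurable [set x].
Proof.
rewrite (_ : [set x] = \big[setI/setT]_(j < d)
    ((fun y : borel_rV R d => (y : 'rV[R]_d) ord0 j) @^-1`
      [set (x : 'rV[R]_d) ord0 j])).
  apply: bigsetI_measurable => j _; rewrite -[X in measurable X]setTI.
  exact: measurable_coord.
apply/seteqP; split => [y ->|y]; rewrite -bigcap_seq; first by move=> j _.
by move=> H; apply/rowP => j; apply: (H j); rewrite /= mem_index_enum.
Qed.

Lemma norm2_sqr (x : 'rV[R]_d) : norm2 x ^+ 2 = \sum_(j < d) x ord0 j ^+ 2.
Proof. by rewrite sqr_sqrtr// sumr_ge0// => j _; exact: sqr_ge0. Qed.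

Lemma measurable_norm2_barycenter_sqr K :
  measurable_fun [set: K.-tuple (borel_rV R d)]
    (fun y : K.-tuple (borel_rV R d) => norm2 (barycenter y) ^+ 2).
Proof.
under eq_fun do rewrite norm2_sqr.
apply: measurable_sum => j; apply: measurable_funX.
under eq_fun do rewrite mxE summxE.
apply: measurable_funM => //; apply: measurable_sum => k.
apply: (measurableT_comp (measurable_coord j)).
exact: measurable_tnth.
Qed.

End borel_rV.

(** * Laws carried by two points *)

Section bernoulli_law.
Context d (T : measurableType d) (R : realType).

Lemma mfun_bool (f : bool -> T) : f \in mfun.
Proof. by rewrite inE. Qed.

(** The target type is arbitrary because the construction serves twice: for the marginals on R^d and
    for a coupling on K-tuples. *)
Definition bernoulli_law (p : R) (f : bool -> T) : probability T R :=
  distribution (bernoulli_prob p) (mfun_Sub (mfun_bool f)).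

Local Open Scope ereal_scope.

Lemma bernoulli_lawE (p : R) (f : bool -> T) A : (0 <= p <= 1)%R ->
  bernoulli_law p f A = p%:E * \d_(f true) A + (1 - p)%:E * \d_(f false) A.
Proof.
by move=> p01; rewrite [LHS](bernoulli_probE p01).
Qed.

Lemma bernoulli_law_atom (p : R) (f : bool -> T) b : (0 <= p <= 1)%R ->
  injective f -> bernoulli_law p f [set f b] = (bernoulli_pmf p b)%:E.
Proof.
move=> p01 fI; rewrite bernoulli_lawE// !diracE !in_set1.
rewrite !(inj_eq fI).
by case: b => /=; rewrite mule1 mule0 ?adde0 ?add0e.
Qed.

Lemma bernoulli_law_range (p : R) (f : bool -> T) (A : set T) :
  (0 <= p <= 1)%R -> (forall b, A (f b)) -> bernoulli_law p f A = 1.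
Proof.
move=> p01 Af; rewrite bernoulli_lawE// !diracE !mem_set// !mule1 -EFinD.
by rewrite subrKC.
Qed.

Lemma integral_bernoulli_law (p : R) (f : bool -> T) (g : T -> \bar R) :
  (0 <= p <= 1)%R -> measurable_fun setT g -> (forall x, 0 <= g x) ->
  \int[bernoulli_law p f]_x g x =
    p%:E * g (f true) + (1 - p)%:E * g (f false).
Proof.
move=> p01 mg g0; rewrite ge0_integral_distribution//.
by rewrite integral_bernoulli_prob// => b; exact: g0.
Qed.

(** A fair bit and its negation have the same law, so a coupling may flip the bit in some
    coordinates without changing the marginals. *)
Lemma bernoulli_law_half_negb (f : bool -> T) (s : bool) A :
  bernoulli_law 2^-1 (fun b => f (b (+) s)) A = bernoulli_law 2^-1 f A.
Proof.
have h : (1 - 2^-1 = 2^-1 :> R)%R by field.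
have p01 : (0 <= 2^-1 :> R)%R && (2^-1 <= 1 :> R)%R.
  by apply/andP; split; lra.
by rewrite !bernoulli_lawE// h; case: s => //=; rewrite addeC.
Qed.

End bernoulli_law.

(** * Two-point marginals on a line and bounds on their [MW2sq] *)

Section atoms.
Context (R : realType) (d : nat) (j0 : 'I_d).

Definition atom (h : R) (b : bool) : borel_rV R d :=
  if b then h *: (delta_mx ord0 j0 : 'rV[R]_d) else (0 : 'rV[R]_d).

Lemma atomE h b j :
  (atom h b : 'rV[R]_d) ord0 j = (h *+ b) *+ (j == j0).
Proof.
case: b; rewrite /atom/= !mxE ?mul0rn//.
by rewrite eqxx mulr1n; case: (j == j0); rewrite ?mulr1 ?mulr0 ?mulr1n ?mulr0n.
Qed.

Lemma atom_inj h : h != 0 -> injective (atom h).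
Proof.
move=> h0 b b' /(congr1 (fun x : 'rV[R]_d => x ord0 j0)).
rewrite !atomE eqxx !mulr1n; case: b b' => -[]//=; rewrite mulr1n mulr0n => hE.
  by rewrite hE eqxx in h0.
by rewrite -hE eqxx in h0.
Qed.

Lemma norm2_line (x : 'rV[R]_d) a : (forall j, x ord0 j = a *+ (j == j0)) ->
  norm2 x ^+ 2 = a ^+ 2.
Proof.
move=> xE; rewrite norm2_sqr (bigD1 j0)//= xE eqxx mulr1n big1 ?addr0//.
by move=> j jj0; rewrite xE (negbTE jj0) mulr0n expr0n.
Qed.

Lemma atom_unit_ball h b : `|h| <= 1 -> unit_ball (atom h b).
Proof.
move=> h1; rewrite /unit_ball/= -(@expr_le1 _ 2)// ?sqrtr_ge0//.
rewrite (norm2_line (atomE h b)).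
case: b; rewrite ?mulr1n ?mulr0n ?expr0n//.
by rewrite -real_normK ?num_real// expr_le1.
Qed.

Lemma barycenter_atom K (h : 'I_K -> R) (b : 'I_K -> bool) j :
  barycenter [tuple atom (h k) (b k) | k < K] ord0 j =
  (K%:R^-1 * \sum_(k < K) h k *+ b k) *+ (j == j0).
Proof.
rewrite mxE summxE -mulrnAr -sumrMnl; congr (_ * _); apply: eq_bigr => k _.
by rewrite tnth_mktuple atomE.
Qed.

(** The square of coordinate [j0] lies above its tangent at [c], and the other squares are dropped.
    The bound is affine in [y], so its integral depends on the marginals only. *)
Lemma norm2_barycenter_sqr_ge K (y : K.-tuple (borel_rV R d)) (c : R) :
  2 * c * (K%:R^-1 * \sum_(k < K) (tnth y k : 'rV[R]_d) ord0 j0) - c ^+ 2 <=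
  norm2 (barycenter y) ^+ 2.
Proof.
rewrite norm2_sqr (bigD1 j0)//= mxE summxE.
set z := K%:R^-1 * _; apply: (@le_trans _ _ (z ^+ 2)).
  rewrite -subr_ge0 (_ : _ - _ = (z - c) ^+ 2) ?sqr_ge0//; ring.
by rewrite lerDl sumr_ge0// => j _; exact: sqr_ge0.
Qed.

Local Open Scope ereal_scope.

(** The coupling drives coordinate [k] by the bit b (+) s k, with one fair [b] for all [k]. Its
    barycenter is constant, so its cost is exactly c^2. *)
Lemma MW2sq_bernoulli_le (K : nat) (h : 'I_K -> R) (s : 'I_K -> bool) (c : R) :
  (forall b, K%:R^-1 * \sum_(k < K) h k *+ (b (+) s k) = c)%R ->
  MW2sq (fun k => bernoulli_law 2^-1 (atom (h k))) <= (c ^+ 2)%:E.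
Proof.
move=> hc; pose f b := [tuple atom (h k) (b (+) s k) | k < K].
have p01 : (0 <= 2^-1 :> R)%R && (2^-1 <= 1 :> R)%R.
  by apply/andP; split; lra.
apply: ge_ereal_inf; exists (c ^+ 2)%:E => //.
exists (bernoulli_law 2^-1 f).
  move=> k A mA; rewrite -(bernoulli_law_half_negb _ _ (s k)).
  rewrite [RHS]bernoulli_lawE//.
  have memE b : (f b \in (fun y => tnth y k) @^-1` A) =
      (atom (h k) (b (+) s k) \in A).
    by apply/idP/idP; rewrite !in_setE/= tnth_mktuple.
  by rewrite /pushforward [LHS]bernoulli_lawE// !diracE !memE.
rewrite integral_bernoulli_law//.
- rewrite !(norm2_line (barycenter_atom _ _)) !hc -!EFinM -EFinD.
  by congr EFin; field.
- apply/measurable_EFinP; exact: measurable_norm2_barycenter_sqr.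
- by move=> y; rewrite lee_fin sqr_ge0.
Qed.

(** Integrating the tangent bound against any coupling leaves the marginal means h k * p. *)
Lemma MW2sq_bernoulli_ge (K : nat) (h : 'I_K -> R) (p c : R) :
  (0 <= p <= 1)%R -> (0 <= c)%R -> (forall k, 0 < h k)%R ->
  (2 * c * (K%:R^-1 * \sum_(k < K) h k * p) - c ^+ 2)%:E <=
  MW2sq (fun k => bernoulli_law p (atom (h k))).
Proof.
move=> p01 c0 h0; apply: le_ereal_inf_tmp => _ /= [gamma gammaP <-].
(* On the atoms, the linear term of the tangent bound is the sum of the indicators of [E k] with
   these weights. *)
pose w k := (2 * c * (K%:R^-1 * h k))%R.
have w0 k : (0 <= w k)%R.
  by rewrite /w !mulr_ge0// ?invr_ge0// ltW.
pose E k : set (K.-tuple (borel_rV R d)) :=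
  (fun y => tnth y k) @^-1` [set atom (h k) true].
have mE k : measurable (E k).
  rewrite -[E k]setTI; apply: measurable_tnth => //; exact: measurable_rV1.
have gammaE k : gamma (E k) = p%:E.
  have := gammaP k _ (measurable_rV1 (atom (h k) true)).
  rewrite /pushforward => ->.
  by rewrite bernoulli_law_atom//; apply: atom_inj; rewrite gt_eqF.
(* Moving c^2 to the right makes both integrands nonnegative. *)
rewrite EFinB leeBlDr//.
rewrite [X in _ <= _ + X](_ : _ = \int[gamma]_y (c ^+ 2)%:E); last first.
  rewrite integral_cst// -[LHS]mule1; congr (_ * _); apply/esym.
  exact: probability_setT.
rewrite -ge0_integralD//; first last.
- by move=> y _; rewrite lee_fin sqr_ge0.
- by apply/measurable_EFinP; exact: measurable_norm2_barycenter_sqr.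
- by move=> y _; rewrite lee_fin sqr_ge0.
rewrite (_ : (2 * c * _)%:E =
    \int[gamma]_y \sum_(k < K) (w k)%:E * (\1_(E k) y)%:E); last first.
  rewrite ge0_integral_sum//.
  - rewrite !mulr_sumr -sumEFin; apply: eq_bigr => k _.
    rewrite ge0_integralZl_EFin//.
    + have -> : \int[gamma]_y (\1_(E k) y)%:E = p%:E.
        rewrite integral_indic// setIT; exact: gammaE.
      by rewrite -EFinM /w !mulrA.
    + by apply/measurable_EFinP.
  - move=> k; apply: measurable_funeM; exact/measurable_EFinP.
  - by move=> k y _; rewrite mule_ge0// lee_fin.
apply: ae_ge0_le_integral => //.
- by move=> y _; apply: sume_ge0 => k _; rewrite mule_ge0// lee_fin.
- apply: emeasurable_sum => k; apply: measurable_funeM.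
  exact/measurable_EFinP.
- by move=> y _; rewrite -EFinD lee_fin addr_ge0 ?sqr_ge0.
- apply: emeasurable_funD => //; apply/measurable_EFinP.
  exact: measurable_norm2_barycenter_sqr.
(* Off the atoms a coordinate could be negative, so the pointwise bound is claimed only on this
   almost sure event, an intersection over finitely many marginals. *)
have range_ae : {ae gamma, forall y k, exists b, tnth y k = atom (h k) b}.
  apply: filter_forall => k.
  pose A : set (borel_rV R d) := [set atom (h k) true] `|` [set atom (h k) false].
  have mA : measurable A by apply: measurableU; exact: measurable_rV1.
  exists (~` ((fun y => tnth y k) @^-1` A)); split.
  - apply: measurableC; rewrite -[X in measurable X]setTI.
    exact: measurable_tnth.
  - rewrite probability_setC; last first.
      rewrite -[X in measurable X]setTI; exact: measurable_tnth.
    have := gammaP k _ mA; rewrite /pushforward => ->.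
    rewrite bernoulli_law_range// ?subee// => -[]; by [left|right].
  - move=> y /=; apply: contra_not => -[] ->; by [exists true|exists false].
apply: filterS range_ae => y yP _.
rewrite sumEFin -EFinD lee_fin -lerBlDr.
apply: le_trans (norm2_barycenter_sqr_ge y c).
rewrite lerD2r !mulr_sumr ler_sum// => k _.
have [b yk] := yP k.
rewrite yk atomE eqxx mulr1n -!mulrA !ler_wpM2l// ?invr_ge0//.
rewrite indicE; case: b yk => yk; rewrite ?mulr1n ?mulr0n.
  by rewrite mem_set// mulr1.
rewrite memNset ?mulr0// /E /preimage/= yk.
by move/(@atom_inj _ (lt0r_neq0 (h0 k)) false true).
Qed.

End atoms.

(** * One-sided errors below the absolute error *)

(** [MW2sq] is extended-real and only bounded on one side in each model. Truncating at 0 keeps the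
    error nonnegative; for infinite [M] the right side is +oo. *)
Lemma max_le_abse_sub_ge (R : realType) (x a : R) (M : \bar R) :
  (M <= a%:E)%E -> ((Num.max 0 (x - a))%:E <= `|x%:E - M|)%E.
Proof.
case: M => [r| |]//=; rewrite ?leey// !lee_fin => ra.
by rewrite ge_max normr_ge0 (le_trans _ (ler_norm _))// lerD2l lerN2.
Qed.

Lemma max_le_abse_sub_le (R : realType) (x b : R) (M : \bar R) :
  (b%:E <= M)%E -> ((Num.max 0 (b - x))%:E <= `|x%:E - M|)%E.
Proof.
case: M => [r| |]//=; rewrite ?leey// !lee_fin => br.
by rewrite ge_max normr_ge0 distrC (le_trans _ (ler_norm _))// lerD2r.
Qed.

(** * From an expectation over independent samples to a finite sum *)

Section independent_bernoulli.
Context (R : realType) dO (Omega : measurableType dO) (P : probability Omega R).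
Context dT (T : measurableType dT) (I : finType) (X : I -> {RV P >-> T}).
Context (p : R) (x : I -> bool -> T).
Hypothesis p01 : 0 <= p <= 1.
Hypothesis x_inj : forall i, injective (x i).
Hypothesis measurable_x : forall i b, measurable [set x i b].
Hypothesis X_indep : mutually_independent X.
Hypothesis X_law : forall i (A : set T), measurable A ->
  distribution P (X i) A = bernoulli_law p (x i) A.

Let E (s : {ffun I -> bool}) := [set w | forall i, X i w = x i (s i)].

Let EE s : E s = \bigcap_(i in [set` [set: I]%SET]) X i @^-1` [set x i (s i)].
Proof.
apply/seteqP; split => [w Ew i _|w Ew i]; first exact: Ew.
by apply: Ew; rewrite /= inE.
Qed.

Let measurable_E s : measurable (E s).
Proof.
rewrite EE; apply: fin_bigcap_measurable => [|i _]; first exact: finite_finset.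
by rewrite -[X in measurable X]setTI; exact: measurable_funP.
Qed.

Let probability_E s : P (E s) = (\prod_i bernoulli_pmf p (s i))%:E.
Proof.
rewrite EE (X_indep [set: I]%SET (A := fun i => [set x i (s i)]))//.
rewrite -prodEFin; apply: eq_big => [i|i _]; first by rewrite inE.
by rewrite -(bernoulli_law_atom _ p01 (@x_inj i)) -X_law.
Qed.

Local Open Scope ereal_scope.

(** The events [E s] are disjoint since the atoms are distinct, and independence gives them product
    probabilities. The step function equal to [v s] on [E s] and 0 elsewhere lies below [g]. *)
Lemma sum_bernoulli_le_integral (g : Omega -> \bar R)
    (v : {ffun I -> bool} -> R) :
  measurable_fun setT g -> (forall s, 0 <= v s)%R ->
  (forall w, 0 <= g w) ->
  (forall (s : {ffun I -> bool}) w, (forall i, X i w = x i (s i)) -> (v s)%:E <= g w) ->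
  (\sum_s v s * \prod_i bernoulli_pmf p (s i))%:E <= \int[P]_w g w.
Proof.
move=> mg v0 g0 vg.
have -> : (\sum_s v s * \prod_i bernoulli_pmf p (s i))%:E =
    \int[P]_w \sum_s (v s)%:E * (\1_(E s) w)%:E.
  rewrite ge0_integral_sum//.
  - rewrite -sumEFin; apply: eq_bigr => s _.
    rewrite ge0_integralZl_EFin//.
    + have -> : \int[P]_w (\1_(E s) w)%:E = P (E s).
        by rewrite integral_indic// setIT.
      by rewrite probability_E -EFinM.
    + by apply/measurable_EFinP.
  - by move=> s; apply: measurable_funeM; exact/measurable_EFinP.
  - by move=> s w _; rewrite mule_ge0// lee_fin.
apply: ge0_le_integral => //.
- by move=> w _; apply: sume_ge0 => s _; rewrite mule_ge0// lee_fin.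
- by apply: emeasurable_sum => s; apply: measurable_funeM; exact/measurable_EFinP.
move=> w _; have [[s0 Es0]|noE] := pselect (exists s, E s w).
  rewrite (bigD1 s0)//= big1 ?adde0 => [|s ss0].
    by rewrite indicE mem_set// mule1; exact: vg.
  rewrite indicE memNset ?mule0// => Es; move/eqP: ss0; apply.
  by apply/ffunP => i; apply: (@x_inj i); rewrite -Es -Es0.
rewrite big1// => s _; rewrite indicE memNset ?mule0// => Es.
by apply: noE; exists s.
Qed.

End independent_bernoulli.

Section data.
Context (R : realType) (d m K : nat) dO (Omega : measurableType dO).
Context (P : probability Omega R) (Y : 'I_m * 'I_K -> {RV P >-> borel_rV R d}).

Lemma measurable_data : measurable_fun [set: Omega] (data Y).
Proof.
apply/measurable_fun_tnthP => i; apply/measurable_fun_tnthP => k.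
rewrite (_ : _ \o _ = Y (i, k)) //.
by apply/funext => w /=; rewrite !tnth_mktuple.
Qed.

End data.

(** * Likelihood ratio, chi-square bound and choice of heights *)

Section likelihood.
Context (R : realType).

Lemma sum_prod_bernoulli_pmf (I : finType) (p : R) :
  \sum_(s : {ffun I -> bool}) \prod_i bernoulli_pmf p (s i) = 1.
Proof.
rewrite -(bigA_distr_bigA (fun _ b => bernoulli_pmf p b)) big1// => i _.
by rewrite big_bool/= subrKC.
Qed.

(** The density of the biased model with respect to the fair one: each factor is (1/2 + e) / (1/2)
    or (1/2 - e) / (1/2). *)
Definition likelihood_ratio (I : finType) (e : R) (s : {ffun I -> bool}) : R :=
  \prod_i (if s i then 1 + 2 * e else 1 - 2 * e).

Lemma likelihood_ratioE (I : finType) (e : R) (s : {ffun I -> bool}) :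
  \prod_i bernoulli_pmf 2^-1 (s i) * likelihood_ratio e s =
  \prod_i bernoulli_pmf (2^-1 + e) (s i).
Proof.
rewrite -big_split/=; apply: eq_bigr => i _.
by rewrite /bernoulli_pmf; case: (s i); field.
Qed.

(** The second moment factorises over the bits, each giving ((1 + 2 e)^2 + (1 - 2 e)^2) / 2. *)
Lemma sum_likelihood_ratio_sqr (I : finType) (e : R) :
  \sum_(s : {ffun I -> bool})
    \prod_i bernoulli_pmf 2^-1 (s i) * likelihood_ratio e s ^+ 2 =
  (1 + 4 * e ^+ 2) ^+ #|I|.
Proof.
under eq_bigr do rewrite -prodrXl -big_split/=.
rewrite -(bigA_distr_bigA (fun _ b => bernoulli_pmf 2^-1 b *
  (if b then 1 + 2 * e else 1 - 2 * e) ^+ 2)).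
under eq_bigr do rewrite big_bool/=.
rewrite prodr_const; congr (_ ^+ _); by field.
Qed.

(** By 1 + x <= exp x the power is at most exp(1/4), and exp(-1/4) >= 1 - 1/4. *)
Lemma chi2_bound (e : R) n : (0 < n)%N -> e ^+ 2 = (16 * n%:R)^-1 ->
  (1 + 4 * e ^+ 2) ^+ n <= 4 / 3.
Proof.
move=> n0 e2; have n0' : (n%:R : R) != 0 by rewrite pnatr_eq0 -lt0n.
have en : n%:R * (4 * e ^+ 2) = 4^-1 by rewrite e2; field.
apply: (@le_trans _ _ (expR (4 * e ^+ 2) ^+ n)).
  rewrite lerXn2r ?nnegrE ?expR_ge0 ?expR_ge1Dx//.
  by rewrite addr_ge0// mulr_ge0// sqr_ge0.
rewrite -expRM_natl en -[_ / 3]invrK -[expR _]invrK -expRN.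
rewrite lef_pV2 ?posrE ?expR_gt0 ?invr_gt0 ?divr_gt0//.
by apply: le_trans (expR_ge1Dx _); lra.
Qed.

(* [s] splits the indices into two groups of the same total height, so that
   switching on one group or the other leaves the barycenter unchanged. When [K]
   is odd the larger group gets heights below [1]. *)
Lemma balanced_heights K : (2 <= K)%N ->
  exists (h : 'I_K -> R) (s : 'I_K -> bool),
  (forall k, 0 < h k <= 1) /\
  (forall b, \sum_(k < K) h k *+ (b (+) s k) = K./2%:R).
Proof.
move=> K2; pose a := K./2.
have aK : (a + a <= K)%N by rewrite addnn -[leqRHS]odd_double_half leq_addl.
have a0 : (0 < a)%N by rewrite half_gt0.
have r0 : (0 < K - a)%N by lia.
have ra : (a <= K - a)%N by lia.
(* The K - a remaining indices share the total [a] equally; [ra] keeps their height at most 1. *)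
exists (fun k : 'I_K => if (k < a)%N then 1 else a%:R / (K - a)%:R).
exists (fun k : 'I_K => (a <= k)%N); split => [k|b].
  case: ifP => _; first by rewrite ltr01 lexx.
  by rewrite divr_gt0 ?ltr0n//= ler_pdivrMr ?ltr0n// mul1r ler_nat.
rewrite -(big_mkord xpredT (fun k => (if (k < a)%N then 1 : R
  else a%:R / (K - a)%:R) *+ (b (+) (a <= k)%N))).
rewrite (@big_cat_nat _ _ _ a)//=; last by lia.
rewrite (eq_big_nat _ _ (F2 := fun=> 1 *+ b)); last first.
  by move=> k /andP[_ ka]; rewrite ka leqNgt ka addbF.
rewrite [X in _ + X](eq_big_nat _ _
  (F2 := fun=> a%:R / (K - a)%:R *+ ~~ b)); last first.
  by move=> k /andP[ak _]; rewrite ltnNge ak addbT.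
rewrite !sumr_const_nat subn0; case: b => /=.
  by rewrite mulr1n mulr0n mul0rn addr0.
rewrite mulr0n mul0rn add0r mulr1n -[LHS]mulr_natr divfK//.
by rewrite pnatr_eq0 -lt0n.
Qed.

End likelihood.

Lemma minimax_rate_le (R : realType) (d K n : nat) :
  (minimax_rate R d K n <= (n%:R `^ (- 2^-1))%:E)%E.
Proof. by rewrite /minimax_rate; case: ifP => // _; rewrite ge_min lexx orbT. Qed.

(** * Risk of an estimator in the two models *)

Section risk.
Context (R : realType) (d : nat) (j0 : 'I_d) (m K : nat) (h : 'I_K -> R).
Hypothesis h01 : forall k, 0 < h k <= 1.
Context (F : m.-tuple (K.-tuple (borel_rV R d)) -> R).
Hypothesis measurable_F :
  measurable_fun [set: m.-tuple (K.-tuple (borel_rV R d))] F.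

Definition atom_data (s : {ffun 'I_m * 'I_K -> bool}) :
    m.-tuple (K.-tuple (borel_rV R d)) :=
  [tuple [tuple atom j0 (h k) (s (i, k)) | k < K] | i < m].

Lemma supported_on_unit_ball p k : 0 <= p <= 1 ->
  @supported_on _ _ R (bernoulli_law p (atom j0 (h k))) (@unit_ball R d).
Proof.
move=> p01; apply: bernoulli_law_range => // b; apply: atom_unit_ball.
by have /andP[h0 h1] := h01 k; rewrite gtr0_norm.
Qed.

Local Open Scope ereal_scope.

(** When every observation is an atom, the data is a function of the bits, so [F] enters only
    through its values at [atom_data s]. *)
Lemma risk_ge (p : R) (M : \bar R) (v : {ffun 'I_m * 'I_K -> bool} -> R)
    dO (Omega : measurableType dO) (P : probability Omega R)
    (Y : 'I_m * 'I_K -> {RV P >-> borel_rV R d}) :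
  (0 <= p <= 1)%R ->
  independent_sample Y (fun k => bernoulli_law p (atom j0 (h k))) ->
  (forall s, 0 <= v s)%R ->
  (forall s, (v s)%:E <= `|(F (atom_data s))%:E - M|) ->
  (\sum_s v s * \prod_i bernoulli_pmf p (s i))%:E <=
  \int[P]_w `|(F (data Y w))%:E - M|.
Proof.
move=> p01 [Ylaw Yind] v0 vF.
apply: (sum_bernoulli_le_integral (X := Y)
  (x := fun ik => atom j0 (h ik.2))) => //.
- move=> [i k]; apply: atom_inj; apply: lt0r_neq0.
  by have /andP[] := h01 k.
- by move=> *; exact: measurable_rV1.
- by move=> [i k] A mA; exact: Ylaw.
- apply: measurableT_comp => //; apply: emeasurable_funB => //.
  apply/measurable_EFinP; apply: measurableT_comp => //.
  exact: measurable_data.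
- move=> s w Yw; rewrite (_ : data Y w = atom_data s)//.
  apply: eq_from_tnth => i; apply: eq_from_tnth => k.
  by rewrite !tnth_mktuple Yw.
Qed.

End risk.

(** The two one-sided errors always add up to at least [D]. The factor 2/3 is 1 - (1/4) (4/3), from
    the second moment bound. *)
Lemma risk_sum_ge (R : realType) (m K : nat) (F : {ffun 'I_m * 'I_K -> bool} -> R)
    (a D e : R) :
  (0 < m * K)%N -> 0 <= e <= 2^-1 -> 0 <= D ->
  e ^+ 2 = (16 * (m * K)%:R)^-1 ->
  2 / 3 * D <=
  \sum_s Num.max 0 (F s - a) * \prod_i bernoulli_pmf 2^-1 (s i) +
  \sum_s Num.max 0 (a + D - F s) * \prod_i bernoulli_pmf (2^-1 + e) (s i).
Proof.
move=> mK0 /andP[e0 e1] D0 e2.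
under [X in _ + X]eq_bigr do rewrite -likelihood_ratioE.
apply: le_trans (le_cam_two_point D0 _ _ _ _ _).
- under [X in X - _]eq_bigr do rewrite likelihood_ratioE.
  rewrite sum_prod_bernoulli_pmf sum_likelihood_ratio_sqr card_prod !card_ord.
  by rewrite mulrC ler_wpM2l//; have := chi2_bound mK0 e2; lra.
- move=> s; apply: prodr_ge0 => i _; apply: bernoulli_pmf_ge0.
  by apply/andP; split; lra.
- by move=> s; apply: prodr_ge0 => i _; case: (s i); lra.
- by move=> s; rewrite le_max lexx.
- by move=> s; rewrite le_max lexx.
- move=> s; apply: (@le_trans _ _ ((F s - a) + (a + D - F s))); first by lra.
  by rewrite lerD// le_max lexx orbT.
Qed.

(** * Choice of the two models and conclusion *)

Local Open Scope ereal_scope.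

Theorem proposition3p2 (R : realType) (d : nat) (hd : (1 <= d)%N) :
  exists2 c : R, (0 < c)%R &
  forall (K n : nat), (2 <= K)%N -> (1 <= n)%N -> (K %| n)%N ->
  forall F : (n %/ K).-tuple (K.-tuple (borel_rV R d)) -> R,
    measurable_fun [set: (n %/ K).-tuple (K.-tuple (borel_rV R d))] F ->
  forall (dO : measure_display) (Omega : measurableType dO)
    (P : ('I_K -> probability (borel_rV R d) R) -> probability Omega R)
    (Y : forall mu : 'I_K -> probability (borel_rV R d) R,
       'I_(n %/ K) * 'I_K -> {RV (P mu) >-> borel_rV R d}),
    (forall mu : 'I_K -> probability (borel_rV R d) R,
       (forall k : 'I_K, supported_on (mu k) (@unit_ball R d)) ->
       independent_sample (Y mu) mu) ->
  ereal_sup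
    [set \int[P mu]_w `| (F (data (Y mu) w))%:E - MW2sq mu |
    | mu in [set mu : 'I_K -> probability (borel_rV R d) R |
             forall k : 'I_K, supported_on (mu k) (@unit_ball R d)]]
  >= c%:E * @minimax_rate R d K n.
Proof.
pose j0 := Ordinal hd.
(* The separation [D] is c^2 r >= r / 9. The two risks add up to at least 2 D / 3, and halving gives
   r / 27. *)
exists 27^-1%R => [|K n K2 n1 Kn F mF dO Omega P Y Yind]; first by rewrite invr_gt0.
have c270 : (0 <= 27^-1 :> R)%R by rewrite invr_ge0.
apply: (le_trans (lee_wpmul2l _ (minimax_rate_le R d K n))); first by rewrite lee_fin.
have [h [s [h01 hs]]] := balanced_heights R K2.
set c := (K%:R^-1 * K./2%:R : R)%R.
set r := (n%:R `^ (- 2^-1) : R)%R.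
pose e := (r / 4)%R.
have n0 : (0 < n%:R :> R)%R by rewrite ltr0n.
have K0 : (0 < K%:R :> R)%R by rewrite ltr0n; lia.
have r0 : (0 <= r)%R by exact: powR_ge0.
have r2 : (r ^+ 2 = n%:R^-1)%R.
  by rewrite -powR_mulrn// -powRrM mulNr mulVf// powRN powRr1// ler0n.
have r1 : (r <= 1)%R.
  by rewrite -(@expr_le1 _ 2)// r2 invf_le1// ler1n.
have e2 : (e ^+ 2 = (16 * (n %/ K * K)%:R)^-1)%R.
  rewrite divnK// exprMn r2; field; exact: lt0r_neq0.
(* The ratio of [K./2] to [K] is smallest at K = 3. *)
have c3 : (3^-1 <= c)%R.
  rewrite /c mulrC ler_pdivlMr// mulrC ler_pdivrMr// -natrM ler_nat.
  have := odd_double_half K; lia.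
(* Each index is switched on for exactly one value of the bit, so adding both cases of [hs] counts
   every height once. *)
have sum_h : (\sum_(k < K) h k = 2 * K./2%:R)%R.
  rewrite mulr_natl mulr2n -{1}(hs true) -(hs false) -big_split/=.
  by apply: eq_bigr => k _; case: (s k); rewrite /= ?mulr1n ?mulr0n ?addr0 ?add0r.
pose mu p k : probability (borel_rV R d) R := bernoulli_law p (atom j0 (h k)).
pose D := (4 * c ^+ 2 * e)%R.
have p0 : (0 <= 2^-1 :> R)%R && (2^-1 <= 1 :> R)%R by apply/andP; split; lra.
have p1 : (0 <= 2^-1 + e)%R && (2^-1 + e <= 1)%R.
  by rewrite /e; apply/andP; split; lra.
have mu0 : MW2sq (mu 2^-1%R) <= (c ^+ 2)%:E.
  by apply: (@MW2sq_bernoulli_le _ _ _ _ _ s) => b; rewrite hs.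
have mu1 : (c ^+ 2 + D)%:E <= MW2sq (mu (2^-1 + e)%R).
  apply: (le_trans _ (@MW2sq_bernoulli_ge _ _ j0 K h _ c p1 _ _)).
  - rewrite lee_fin -mulr_suml sum_h /D [leRHS](_ : _ =
      2 * c * (2 * (K%:R^-1 * K./2%:R) * (2^-1 + e)) - c ^+ 2)%R; last by ring.
    by rewrite -/c le_eqVlt; apply/orP; left; apply/eqP; field.
  - by lra.
  - by move=> k; have /andP[] := h01 k.
have D0 : (0 <= D)%R by rewrite /D /e !mulr_ge0 ?sqr_ge0// divr_ge0.
have rD : (27^-1 * r * 2 <= 2 / 3 * D)%R.
  have c2 : (9^-1 <= c ^+ 2)%R by nra.
  rewrite [leLHS](_ : _ = 2 / 3 * r * 9^-1)%R; last by field.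
  rewrite [leRHS](_ : _ = 2 / 3 * r * c ^+ 2)%R; last by rewrite /D /e; field.
  by rewrite ler_wpM2l// mulr_ge0// divr_ge0.
have sup_ge p v : (0 <= p <= 1)%R -> (forall s, 0 <= v s)%R ->
  (forall s, (v s)%:E <= `|(F (atom_data j0 h s))%:E - MW2sq (mu p)|) ->
  (27^-1 * r <= \sum_s v s * \prod_i bernoulli_pmf p (s i))%R ->
  27^-1%:E * r%:E <= ereal_sup
    [set \int[P mu]_w `| (F (data (Y mu) w))%:E - MW2sq mu |
    | mu in [set mu : 'I_K -> probability (borel_rV R d) R |
             forall k : 'I_K, supported_on (mu k) (@unit_ball R d)]].
  move=> p01 v0 vF rv.
  have mu_ball k : supported_on (mu p k) (@unit_ball R d).
    exact: supported_on_unit_ball.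
  apply: le_ereal_sup_tmp; eexists; first by exists (mu p).
  apply: le_trans (risk_ge h01 mF p01 (Yind _ mu_ball) v0 vF).
  by rewrite -EFinM lee_fin.
have mK0 : (0 < n %/ K * K)%N by rewrite divnK.
have e01 : (0 <= e <= 2^-1)%R by rewrite /e; apply/andP; split; lra.
have := risk_sum_ge (fun s => F (atom_data j0 h s)) (c ^+ 2) mK0 e01 D0 e2.
set S0 := (\sum_s _)%R; set S1 := (\sum_s _)%R => S01.
(* One of the two sums carries at least half of the total; the corresponding model witnesses the
   supremum. *)
have [S0r|S0r] := leP (27^-1 * r)%R S0.
  apply: (sup_ge _ _ p0 _ _ S0r) => t; first by rewrite le_max lexx.
  exact: max_le_abse_sub_ge.
have S1r : (27^-1 * r <= S1)%R by lra.
apply: (sup_ge _ _ p1 _ _ S1r) => t; first by rewrite le_max lexx.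
exact: max_le_abse_sub_le.
Qed.
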